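(* Let $V=\{1,\dots,n\}$, let $E,E'$ be sets of edges (unordered pairs of distinct vertices) on $V$, let $w_{j,k}\ge 0$ for $(j,k)\in E$, $w'_{j,k}\in\mathbb{R}$ for $(j,k)\in E'$, and $\mu_j\in\mathbb{R}$ for $j\in V$. Consider the $2^n\times 2^n$ Hermitian matrix $$H=\sum_{(j,k)\in E}w_{j,k}\Big(\tfrac14\mathbb{1}-n_jn_k\Big)+\sum_{j\in V}\mu_j\Big(n_j-\tfrac12\mathbb{1}\Big)+\sum_{(j,k)\in E'}w'_{j,k}\big(-a_j^\dagger a_k-a_k^\dagger a_j\big).$$ Then there exists a pure fermionic Gaussian state $\rho$ such that $$\mathrm{Tr}(\rho H)\ \ge\ \tfrac13\,\lambda_{\max}(H),$$ where $\lambda_{\max}(H)=\max\{\mathrm{Tr}(\sigma H):\sigma\in\mathbb{C}^{2^n\times 2^n},\ \sigma\succeq 0,\ \mathrm{Tr}(\sigma)=1\}$.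
   Context: Fermionic modes: $a_1,\dots,a_n\in\mathbb{C}^{2^n\times 2^n}$ are annihilation operators satisfying $a_ja_k^\dagger+a_k^\dagger a_j=\delta_{jk}\mathbb{1}$ and $a_ja_k+a_ka_j=0$, with a vacuum vector $|\mathrm{vac}\rangle$ such that $a_j|\mathrm{vac}\rangle=0$ for all $j$; $n_j=a_j^\dagger a_j$. Majorana operators: $c_{2k-1}=a_k+a_k^\dagger$, $c_{2k}=i(a_k-a_k^\dagger)$, $k=1,\dots,n$; they are Hermitian and satisfy $c_jc_k+c_kc_j=2\delta_{jk}\mathbb{1}$. Fermionic Gaussian state: a density matrix of the form $\rho=\frac{1}{2^n}\prod_{j=1}^n(\mathbb{1}+i\lambda_j\tilde c_{2j-1}\tilde c_{2j})$ with $\lambda_j\in[-1,1]$ and $\tilde c_j=\sum_kR_{j,k}c_k$ for some $R\in SO(2n)$ (normalized exponentials of quadratic Majorana forms and their limits). It is pure iff all $\lambda_j=\pm1$. *)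

(* Defs.v *)
From HB Require Import structures.
From mathcomp Require Import all_boot all_order all_algebra.
From mathcomp Require Import complex classical_sets reals.

Set Implicit Arguments.
Unset Strict Implicit.
Unset Printing Implicit Defensive.

Import Order.TTheory GRing.Theory Num.Theory.

Local Open Scope ring_scope.
Local Open Scope complex_scope.
Local Open Scope sesquilinear_scope.

Section States.
Variables (R : realType) (N : nat).
Implicit Types (H rho sigma : 'M[R[i]]_N).

(* The order on R[i] is the partial one: 0 <= z means that z is real and
   nonnegative. *)
Definition psd sigma : Prop :=
  sigma \is hermsymmx /\
  forall v : 'cV[R[i]]_N, 0 <= (v ^t* *m sigma *m v) 0 0.

Definition density sigma : Prop := psd sigma /\ \tr sigma = 1.

Definition pure sigma : Prop :=
  exists psi : 'cV[R[i]]_N,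
    psi ^t* *m psi = 1%:M /\ sigma = psi *m psi ^t*.

Definition energies H : set R :=
  [set x | exists sigma, density sigma /\ \tr (sigma *m H) = x%:C]%classic.

(* For a Hermitian H of positive size this supremum is a maximum; see
   [lambda_maxP] below. *)
Definition lambda_max H : R := sup (energies H).

End States.

Lemma lambda_maxP (R : realType) (N : nat) (H : 'M[R[i]]_N) :
  (0 < N)%N -> H \is hermsymmx ->
  energies H (lambda_max H) /\ forall x, energies H x -> x <= lambda_max H.
Proof.
move=> N0 Hh.
pose P := spectralmx H; pose d : 'rV[R[i]]_N := spectral_diag H.
pose e k : R := complex.Re (d 0 k).
have Pu : P \is unitarymx by exact: spectral_unitarymx.
have /orthomx_spectralP HE := hermitian_normalmx Hh.
have HE' : H = P ^t* *m diag_mx d *m P by rewrite -invmx_unitary.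
have dr k : (e k)%:C = d 0 k.
  have /mxOverP/(_ 0 k) := hermitian_spectral_diag_real Hh.
  exact: RRe_real.
have trE sigma : \tr (sigma *m H) =
    \sum_k (P *m sigma *m P ^t*) k k * (e k)%:C.
  rewrite HE' mulmxA mxtrace_mulC !mulmxA /mxtrace; apply: eq_bigr => k _.
  by rewrite mul_mx_diag mxE -dr.
have trP sigma : \sum_k (P *m sigma *m P ^t*) k k = \tr sigma.
  rewrite -/(\tr _) mxtrace_mulC mulmxA -invmx_unitary // mulVmx ?mul1mx //.
  exact: unitarymx_unit.
pose k0 : 'I_N := Ordinal N0.
pose km := [arg max_(k > k0) e k]%O.
have kmP k : e k <= e km.
  by rewrite /km; case: arg_maxP => // i _ /(_ k isT).
have ub x : energies H x -> x <= e km.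
  case=> sigma [[[_ sp] s1] sx].
  suff: x%:C <= (e km)%:C by rewrite lecR.
  rewrite -sx trE -[leRHS]mul1r -s1 -trP mulr_suml; apply: ler_sum => k _.
  apply: ler_wpM2l; last by rewrite lecR.
  have := sp ((row k P) ^t*); rewrite trmxCK.
  congr (_ <= _).
  rewrite -row_mul -[RHS]/((P *m sigma *m P ^t*) k k).
  rewrite !mxE; apply: eq_bigr => j _; congr (_ * _); first by rewrite !mxE.
  by rewrite !mxE.
have mem : energies H (e km).
  pose v := row km P.
  exists (v ^t* *m v); split; first split; first split.
  - apply/is_hermitianmxP; rewrite expr0 scale1r trmx_mul map_mxM trmxCK.
    by [].
  - move=> u.
    set z := v *m u.
    have -> : u ^t* *m (v ^t* *m v) *m u = z ^t* *m z.
      by rewrite /z trmx_mul map_mxM !mulmxA.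
    by rewrite mxE big_ord1 !mxE mulrC mul_conjC_ge0.
  - rewrite mxtrace_mulC /v; move/row_unitarymxP: (Pu) => /(_ km km).
    rewrite dotmxE eqxx => vv.
    by rewrite /mxtrace big_ord1 vv.
  - have vP : v *m P ^t* = delta_mx 0 km.
      by rewrite /v -row_mul (unitarymxP Pu) row1.
    have Pv : P *m v ^t* = delta_mx km 0.
      rewrite -[LHS]trmxCK trmx_mul map_mxM trmxCK vP.
      by rewrite trmx_delta map_delta_mx.
    have PP k : (P *m (v ^t* *m v) *m P ^t*) k k = (k == km)%:R.
      rewrite mulmxA Pv -mulmxA vP mul_delta_mx mxE.
      by rewrite andbb.
    rewrite trE (bigD1 km) //= big1 => [|k kk].
      by rewrite PP eqxx mul1r addr0.
    by rewrite PP (negbTE kk) mul0r.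
suff -> : lambda_max H = e km by [].
apply/eqP; rewrite eq_le; apply/andP; split.
  by apply: ge_sup => //; exists (e km).
by apply: ub_le_sup => //; exists (e km).
Qed.

Section Fermions.
Variables (R : realType) (n : nat).
Local Notation op := 'M[R[i]]_(2 ^ n).
Implicit Types (a : 'I_n -> op) (rho : op).

Definition fermionic_modes a : Prop :=
  (forall j k, a j *m (a k) ^t* + (a k) ^t* *m a j = (j == k)%:R%:M) /\
  (forall j k, a j *m a k + a k *m a j = 0).

Definition vacuum a (vac : 'cV[R[i]]_(2 ^ n)) : Prop :=
  vac != 0 /\ forall j, a j *m vac = 0.

Definition number a (j : 'I_n) : op := (a j) ^t* *m a j.

Lemma mode_subproof (m : 'I_n.*2) : (m./2 < n)%N.
Proof. by rewrite ltn_half_double. Qed.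

Lemma even_subproof (j : 'I_n) : (j.*2 < n.*2)%N.
Proof. by rewrite ltn_double. Qed.

Lemma odd_subproof (j : 'I_n) : (j.*2.+1 < n.*2)%N.
Proof. by rewrite ltn_Sdouble. Qed.

Definition mode (m : 'I_n.*2) : 'I_n := Ordinal (mode_subproof m).
Definition maj1 (j : 'I_n) : 'I_n.*2 := Ordinal (even_subproof j).
Definition maj2 (j : 'I_n) : 'I_n.*2 := Ordinal (odd_subproof j).

(* Indices start at 0, so that c_{2k-1} and c_{2k}, with k counted from 1, have
   even and odd index respectively. *)
Definition majorana a (m : 'I_n.*2) : op :=
  let k := mode m in
  if odd m then 'i *: (a k - (a k) ^t*) else a k + (a k) ^t*.

Definition special_orthogonal m (Q : 'M[R]_m) : Prop :=
  Q *m Q^T = 1%:M /\ \det Q = 1.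

Definition rotated_majorana a (Q : 'M[R]_n.*2) (m : 'I_n.*2) : op :=
  \sum_k (Q m k)%:C *: majorana a k.

Definition gaussian_form a (Q : 'M[R]_n.*2) (lam : 'I_n -> R) : op :=
  let c := rotated_majorana a Q in
  (2 ^ n)%:R^-1 *:
    \prod_(j < n)
      (1%:M + ('i * (lam j)%:C) *: (c (maj1 j) *m c (maj2 j))).

Definition gaussian a rho : Prop :=
  density rho /\
  exists (Q : 'M[R]_n.*2) (lam : 'I_n -> R),
    [/\ special_orthogonal Q,
        forall j, -1 <= lam j <= 1
      & rho = gaussian_form a Q lam].

Definition pure_gaussian a rho : Prop := gaussian a rho /\ pure rho.

(* Edges are unordered pairs: each is counted once, as [set j; k] with j < k. *)
Definition hamiltonian a (E E' : {set {set 'I_n}}) (w w' : {set 'I_n} -> R)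
    (mu : 'I_n -> R) : op :=
    \sum_(j < n) \sum_(k < n | (j < k)%N && ([set j; k] \in E))
      (w [set j; k])%:C *: (4^-1%:M - number a j *m number a k)
  + \sum_(j < n) (mu j)%:C *: (number a j - 2^-1%:M)
  + \sum_(j < n) \sum_(k < n | (j < k)%N && ([set j; k] \in E'))
      (w' [set j; k])%:C *: (- ((a j) ^t* *m a k) - (a k) ^t* *m a j).

Lemma hamiltonian_hermitian a E E' w w' mu :
  fermionic_modes a -> hamiltonian a E E' w w' mu \is hermsymmx.
Proof.
move=> [car1 car2].
have adjD (A B : op) : (A + B) ^t* = A ^t* + B ^t*.
  by rewrite linearD map_mxD.
have adjN (A : op) : (- A) ^t* = - A ^t* by rewrite linearN map_mxN.
have adjM (A B : op) : (A *m B) ^t* = B ^t* *m A ^t*.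
  by rewrite trmx_mul map_mxM.
have adjZ (x : R) (A : op) : (x%:C *: A) ^t* = x%:C *: A ^t*.
  rewrite linearZ map_mxZ; congr (_ *: _).
  by rewrite -[LHS]/(conjc x%:C) conjc_real.
have adjS (x : R[i]) : x \is Num.real -> (x%:M : op) ^t* = x%:M.
  by move=> xr; rewrite tr_scalar_mx map_scalar_mx; congr _%:M; apply/CrealP.
have adj_sum (I : finType) (P : pred I) (F : I -> op) :
    (forall i, P i -> (F i) ^t* = F i) ->
    (\sum_(i | P i) F i) ^t* = \sum_(i | P i) F i.
  move=> FE; rewrite raddf_sum raddf_sum; exact: eq_bigr.
have adj_num j : (number a j) ^t* = number a j.
  by rewrite /number adjM trmxCK.
have num_comm j k : j != k ->
    number a k *m number a j = number a j *m number a k.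
  move=> jk.
  have aad i l : i != l -> a i *m (a l) ^t* = - ((a l) ^t* *m a i).
    move=> il; apply/eqP; rewrite -addr_eq0 car1 (negbTE il).
    by apply/eqP/matrixP => x y; rewrite !mxE mul0rn.
  have aa i l : a i *m a l = - (a l *m a i).
    by apply/eqP; rewrite -addr_eq0 car2.
  have dd i l : (a i) ^t* *m (a l) ^t* = - ((a l) ^t* *m (a i) ^t*).
    by rewrite -!adjM -adjN -aa.
  have kj : k != j by rewrite eq_sym.
  rewrite /number -mulmxA (mulmxA (a k)) (aad _ _ kj) mulNmx mulmxN.
  rewrite -mulmxA (aa k) !mulmxN opprK mulmxA dd mulNmx -mulmxA.
  by rewrite (mulmxA _ (a j)) -[_ *m a j]opprK -(aad _ _ jk) mulNmx mulmxN
    opprK !mulmxA.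
apply/is_hermitianmxP; rewrite expr0 scale1r; apply/esym.
rewrite /hamiltonian !adjD; congr (_ + _ + _).
- apply: (adj_sum) => j _; apply: (adj_sum) => k /andP[jk _].
  rewrite adjZ adjD adjN adjM !adj_num num_comm; last by rewrite -val_eqE /= neq_ltn jk orbT.
  by rewrite adjS // rpredV realn.
- apply: (adj_sum) => j _; rewrite adjZ adjD adjN adj_num.
  by rewrite adjS // rpredV realn.
- apply: (adj_sum) => j _; apply: (adj_sum) => k _.
  by rewrite adjZ adjD !adjN !adjM !trmxCK addrC.
Qed.

End Fermions.

(* Main.v *)
(* Write H = D + T with D diagonal in the occupation basis and T the hopping
   part, and let sigma attain lambda_max. Measuring sigma in the occupation basis
   gives a mixture of occupation states, on which T vanishes, so some occupation
   state has energy at least tr(sigma D). On the other hand, let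
   C_jk = tr(sigma a_j^* a_k) and C' = (1 + C - diag C)/2. Since 0 <= C <= 1 also
   0 <= C' <= 1, so C' is the correlation matrix of a Gaussian state rho, and
   tr(rho T) = tr(sigma T)/2, the chemical potentials contribute 0, and by Wick's
   theorem each interaction contributes w_jk |C'_jk|^2 >= 0. A mixed Gaussian
   state being a mixture of pure ones, some pure Gaussian state has energy at
   least tr(sigma T)/2. As tr(sigma D) + tr(sigma T) = lambda_max, one of the
   bounds tr(sigma D), tr(sigma T)/2 is at least lambda_max/3. *)

Require Import Defs.
From mathcomp Require Import all_boot all_order all_algebra.
From mathcomp Require Import complex reals ring lra.

Set Implicit Arguments.
Unset Strict Implicit.
Unset Printing Implicit Defensive.

Import Order.TTheory GRing.Theory Num.Theory.

Local Open Scope complex_scope.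
Local Open Scope ring_scope.
Local Open Scope sesquilinear_scope.

(** * Adjoints, and traces of the form tr(A^* A) *)

Section Adjoint.
Variable C : numClosedFieldType.

Lemma adjM m n p (A : 'M[C]_(m, n)) (B : 'M[C]_(n, p)) :
  (A *m B) ^t* = B ^t* *m A ^t*.
Proof. by rewrite trmx_mul map_mxM. Qed.

Lemma adjD m n (A B : 'M[C]_(m, n)) : (A + B) ^t* = A ^t* + B ^t*.
Proof. by rewrite linearD map_mxD. Qed.

Lemma adjN m n (A : 'M[C]_(m, n)) : (- A) ^t* = - A ^t*.
Proof. by rewrite linearN map_mxN. Qed.

Lemma adjZ m n (x : C) (A : 'M[C]_(m, n)) : (x *: A) ^t* = x^* *: A ^t*.
Proof. by rewrite linearZ map_mxZ. Qed.

Lemma adj_sum m n (I : finType) (P : pred I) (F : I -> 'M[C]_(m, n)) :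
  (\sum_(i | P i) F i) ^t* = \sum_(i | P i) (F i) ^t*.
Proof. by rewrite !raddf_sum. Qed.

Lemma adj1 n : (1%:M : 'M[C]_n) ^t* = 1%:M.
Proof. by rewrite trmx1 map_mx1. Qed.

Lemma adj0 m n : (0 : 'M[C]_(m, n)) ^t* = 0.
Proof. by rewrite trmx0 map_mx0. Qed.

Lemma mxtrace_adj n (A : 'M[C]_n) : \tr (A ^t*) = (\tr A)^*.
Proof. by rewrite trace_map_mx mxtrace_tr. Qed.

Lemma mxtrace_adj_mul m n (A : 'M[C]_(m, n)) :
  \tr (A ^t* *m A) = \sum_j \sum_i `|A i j| ^+ 2.
Proof.
apply: eq_bigr => j _; rewrite mxE; apply: eq_bigr => i _.
by rewrite !mxE normCK mulrC.
Qed.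

Lemma mxtrace_adj_mul_eq0 m n (A : 'M[C]_(m, n)) :
  \tr (A ^t* *m A) = 0 -> A = 0.
Proof.
rewrite mxtrace_adj_mul => /eqP; rewrite psumr_eq0 => [/allP A0|j _]; last first.
  by apply: sumr_ge0 => i _; rewrite exprn_ge0.
apply/matrixP => i j; rewrite mxE; apply/eqP.
have := A0 j (mem_index_enum _); rewrite psumr_eq0 => [/allP/(_ i)|k _].
  by rewrite mem_index_enum => /(_ isT); rewrite expf_eq0 /= normr_eq0.
by rewrite exprn_ge0.
Qed.

Lemma scalemx_prod (m : nat) (I : Type) (r : seq I) (F : I -> C) (G : I -> 'M[C]_m) :
  \prod_(i <- r) (F i *: G i) = (\prod_(i <- r) F i) *: \prod_(i <- r) G i.
Proof.
elim: r => [|i r IH]; first by rewrite !big_nil scale1r.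
by rewrite !big_cons IH -[LHS]/(_ *m _) -scalemxAl -scalemxAr scalerA.
Qed.

End Adjoint.

(** * Rank-one projections and positivity of traces *)

Section RankOne.
Variables (R : realType) (N : nat).

Lemma psi_density (psi : 'cV[R[i]]_N) :
  psi ^t* *m psi = 1%:M -> density (psi *m psi ^t*).
Proof.
move=> psi1; split; last by rewrite mxtrace_mulC psi1 mxtrace1.
split; first by apply/is_hermitianmxP; rewrite expr0 scale1r adjM trmxCK.
move=> v; have -> : v ^t* *m (psi *m psi ^t*) *m v =
    (psi ^t* *m v) ^t* *m (psi ^t* *m v) by rewrite adjM trmxCK !mulmxA.
by rewrite mxE big_ord1 !mxE mulrC mul_conjC_ge0.
Qed.

(* Subtracting from P the projection on a unit vector of its range leaves a
   Hermitian idempotent of trace 0, hence 0. *)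
Lemma projection_trace1_pure (P : 'M[R[i]]_N) :
  P ^t* = P -> P *m P = P -> \tr P = 1 -> pure P.
Proof.
move=> PH PP P1.
have [k vk0] : exists k, col k P != 0.
  apply/existsP; apply: contraT; rewrite negb_exists => /forallP P0.
  have : P = 0.
    apply/matrixP => i j; have := P0 j; rewrite negbK => /eqP/matrixP/(_ i 0).
    by rewrite !mxE.
  by move=> PE; move: P1; rewrite PE mxtrace0 => /esym/eqP; rewrite oner_eq0.
set v := col k P in vk0 *.
pose s := \tr (v ^t* *m v).
have s_ge0 : 0 <= s.
  by rewrite /s mxtrace_adj_mul; do 2! (apply: sumr_ge0 => ? _); rewrite exprn_ge0.
have s_neq0 : s != 0.
  by apply: contra vk0 => /eqP /mxtrace_adj_mul_eq0 ->.
have vv : v ^t* *m v = s%:M.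
  by rewrite [LHS]mx11_scalar; congr _%:M; rewrite /s /mxtrace big_ord1.
have Pv : P *m v = v by rewrite /v !colE mulmxA PP.
have sq : (sqrtC s)^* = sqrtC s by apply/CrealP; rewrite ger0_real ?sqrtC_ge0.
pose psi := (sqrtC s)^-1 *: v.
have psi1 : psi ^t* *m psi = 1%:M.
  rewrite /psi adjZ -scalemxAl -scalemxAr vv fmorphV /= sq scalerA -expr2 exprVn.
  by rewrite sqrtCK scale_scalar_mx mulVf.
have Ppsi : P *m psi = psi by rewrite /psi -scalemxAr Pv.
have psiP : psi ^t* *m P = psi ^t* by rewrite -{2}Ppsi adjM PH.
exists psi; split => //; apply/subr0_eq/mxtrace_adj_mul_eq0.
rewrite adjD adjN PH adjM trmxCK mulmxBl !mulmxBr PP !mulmxA Ppsi.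
rewrite -(mulmxA psi) psiP -(mulmxA psi (psi ^t*) psi) psi1 mulmx1 subrr subr0.
by rewrite raddfB /= P1 mxtrace_mulC psi1 mxtrace1 subrr.
Qed.

(** By cyclicity the trace is that of B sigma B^*, whose diagonal entries are the quadratic form of
    [sigma] at the adjoints of the rows of [B]. *)
Lemma psd_trace_ge0 (sigma : 'M[R[i]]_N) (m : nat) (B : 'M[R[i]]_(m, N)) :
  psd sigma -> 0 <= \tr (sigma *m (B ^t* *m B)).
Proof.
move=> [_ sp]; rewrite mulmxA mxtrace_mulC mulmxA.
apply: sumr_ge0 => k _; have := sp ((row k B) ^t*); rewrite trmxCK.
suff -> : (row k B *m sigma *m (row k B) ^t*) 0 0 = (B *m sigma *m B ^t*) k k by [].
rewrite -row_mul !mxE; apply: eq_bigr => j _.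
by rewrite !mxE.
Qed.

End RankOne.

(** * Anticommutation relations and product states for one family of modes *)

Section Modes.
Variables (R : realType) (n : nat).
Local Notation op := 'M[R[i]]_(2 ^ n).
Variable b : 'I_n -> op.
Hypothesis hb : fermionic_modes b.
Local Notation N := (Defs.number b).
Implicit Types (c : 'I_n -> R[i]) (p q k : 'I_n) (r : seq 'I_n).

Lemma car p q : b p *m (b q) ^t* = (p == q)%:R%:M - (b q) ^t* *m b p.
Proof. by rewrite -hb.1 addrK. Qed.

Lemma car_rev p q : (b q) ^t* *m b p + b p *m (b q) ^t* = (p == q)%:R%:M.
Proof. by rewrite addrC hb.1. Qed.

Lemma carN p q : b p *m b q = - (b q *m b p).
Proof. by apply/eqP; rewrite -addr_eq0 hb.2. Qed.

Lemma adj_carN p q : (b p) ^t* *m (b q) ^t* = - ((b q) ^t* *m (b p) ^t*).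
Proof. by rewrite -!adjM carN adjN. Qed.

Lemma mode_sqr p : b p *m b p = 0.
Proof.
have /eqP := hb.2 p p; rewrite -mulr2n -scaler_nat scaler_eq0 pnatr_eq0 /=.
by move/eqP.
Qed.

Lemma adj_mode_sqr p : (b p) ^t* *m (b p) ^t* = 0.
Proof. by rewrite -adjM mode_sqr adj0. Qed.

Lemma number_adj p : (N p) ^t* = N p.
Proof. by rewrite /Defs.number adjM trmxCK. Qed.

Lemma number_creation p : N p *m (b p) ^t* = (b p) ^t*.
Proof.
by rewrite /Defs.number -mulmxA car eqxx mulmxBr mulmx1 mulmxA adj_mode_sqr mul0mx
  subr0.
Qed.

Lemma creation_number p : (b p) ^t* *m N p = 0.
Proof. by rewrite /Defs.number mulmxA adj_mode_sqr mul0mx. Qed.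

Lemma number_idem p : N p *m N p = N p.
Proof. by rewrite {2}/Defs.number mulmxA number_creation. Qed.

Lemma number_creation_comm p q : p != q ->
  N p *m (b q) ^t* = (b q) ^t* *m N p.
Proof.
move=> /negbTE pq; rewrite /Defs.number -mulmxA car pq raddf0 sub0r mulmxN [RHS]mulmxA.
by rewrite adj_carN mulNmx mulmxA.
Qed.

Lemma number_annihilation_comm p q : p != q -> N p *m b q = b q *m N p.
Proof.
move=> pq; have := congr1 (fun A => A ^t*) (number_creation_comm pq).
by rewrite /= [LHS]adjM [RHS]adjM trmxCK number_adj => ->.
Qed.

Lemma number_comm p q : N p *m N q = N q *m N p.
Proof.
have [->//|pq] := eqVneq p q.
rewrite [N q]/Defs.number mulmxA number_creation_comm // -mulmxA.
by rewrite [X in _ *m X]number_annihilation_comm // mulmxA.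
Qed.

(** When all [c p] lie in [0,1], the product of these factors over all modes is the state in which
    the modes are occupied independently with probabilities [c p]. Values 0 and 1 give the
    projection onto an occupation basis vector. *)
Definition occupation_factor c p : op :=
  c p *: N p + (1 - c p) *: (1%:M - N p).

Definition occupation_prod c r : op := \prod_(p <- r) occupation_factor c p.

Local Notation A := occupation_factor.
Local Notation P := occupation_prod.

Lemma occupation_nil c : P c [::] = 1%:M.
Proof. by rewrite /P big_nil. Qed.

Lemma occupation_cons c p r : P c (p :: r) = A c p *m P c r.
Proof. by rewrite /P big_cons. Qed.

Lemma factor_comm c p (X : op) : N p *m X = X *m N p -> A c p *m X = X *m A c p.
Proof.
move=> NX; rewrite /A mulmxDl mulmxDr -!scalemxAl -!scalemxAr NX.
by rewrite mulmxBl mulmxBr mul1mx mulmx1 NX.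
Qed.

Lemma occupation_comm c r (X : op) : (forall p, p \in r -> N p *m X = X *m N p) ->
  P c r *m X = X *m P c r.
Proof.
elim: r => [|p r IH] NX; first by rewrite occupation_nil mul1mx mulmx1.
rewrite occupation_cons -mulmxA IH => [|q qr]; last by rewrite NX // inE qr orbT.
by rewrite !mulmxA factor_comm // NX // inE eqxx.
Qed.

Lemma factor_creation c p : A c p *m (b p) ^t* = c p *: (b p) ^t*.
Proof.
rewrite /A mulmxDl -!scalemxAl mulmxBl mul1mx number_creation subrr scaler0.
by rewrite addr0.
Qed.

Lemma creation_factor c p : (b p) ^t* *m A c p = (1 - c p) *: (b p) ^t*.
Proof.
rewrite /A mulmxDr -!scalemxAr mulmxBr mulmx1 creation_number subr0.
by rewrite scaler0 add0r.
Qed.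

(** Factors of other modes commute with the creation operator, while the factor of mode [k]
    multiplies it by [c k] from the left and by [1 - c k] from the right. The relation is
    cross-multiplied rather than divided, so that [c k = 1] is covered. *)
Lemma occupation_creation c r k : uniq r -> k \in r ->
  (1 - c k) *: (P c r *m (b k) ^t*) = c k *: ((b k) ^t* *m P c r).
Proof.
elim: r => [//|p r IH] /= /andP[pr ur]; rewrite inE occupation_cons.
have [kp|kp] := eqVneq k p => /= kr; first subst p.
  rewrite -mulmxA occupation_comm => [|q qr]; last first.
    by rewrite number_creation_comm //; apply: contraNneq pr => <-.
  rewrite !mulmxA factor_creation creation_factor -!scalemxAl !scalerA.
  by rewrite mulrC.
rewrite -mulmxA scalemxAr IH // -scalemxAr !mulmxA factor_comm //.
by rewrite number_creation_comm // eq_sym.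
Qed.

Lemma factor_adj c p : (c p) ^* = c p -> (A c p) ^t* = A c p.
Proof.
by move=> cp; rewrite /A adjD !adjZ adjD adjN adj1 number_adj rmorphB rmorph1 /= cp.
Qed.

Lemma occupation_adj c r : (forall p, (c p) ^* = c p) -> (P c r) ^t* = P c r.
Proof.
move=> cr; elim: r => [|p r IH]; first by rewrite occupation_nil adj1.
rewrite occupation_cons adjM IH factor_adj // occupation_comm // => q _.
by apply/esym/factor_comm/number_comm.
Qed.

Lemma factor_idem c p : c p * c p = c p -> A c p *m A c p = A c p.
Proof.
move=> cc; have c1 : (1 - c p) * (1 - c p) = 1 - c p.
  by rewrite mulrBr mulr1 mulrBl mul1r cc subrr subr0.
rewrite {2}/A mulmxDr -!scalemxAr mulmxBr mulmx1.
have -> : A c p *m N p = c p *: N p.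
  rewrite /A mulmxDl -!scalemxAl mulmxBl mul1mx number_idem subrr scaler0.
  by rewrite addr0.
rewrite {1}/A addrAC subrr add0r !scalerA cc c1.
by rewrite /A.
Qed.

Lemma occupation_idem c r : (forall p, c p * c p = c p) ->
  P c r *m P c r = P c r.
Proof.
move=> cc; elim: r => [|p r IH]; first by rewrite occupation_nil mul1mx.
rewrite occupation_cons mulmxA -(mulmxA (A c p)) occupation_comm => [|q _].
  by rewrite mulmxA factor_idem // -mulmxA IH.
by apply/esym/factor_comm/number_comm.
Qed.

(** For [p] outside [r], the product over [r] commutes with the creation operator of [p]. Cyclicity
    then gives N and 1 - N of mode [p] the same trace against this product, so each new factor
    halves the trace, whatever [c p] is. *)
Lemma occupation_trace c r : uniq r ->
  (2 ^ size r)%:R * \tr (P c r) = (2 ^ n)%:R.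
Proof.
elim: r => [_|p r IH /= /andP[pr ur]]; first by rewrite occupation_nil mxtrace1 mul1r.
have tN : \tr (N p *m P c r) = \tr (b p *m (b p) ^t* *m P c r).
  rewrite /Defs.number -!mulmxA mxtrace_mulC -mulmxA occupation_comm // => q qr.
  by rewrite number_creation_comm //; apply: contraNneq pr => <-.
have {}tN : \tr (N p *m P c r) = \tr (P c r) - \tr (N p *m P c r).
  by rewrite {1}tN car eqxx mulmxBl mul1mx raddfB.
rewrite expnS mulnC natrM -mulrA occupation_cons -(IH ur); congr (_ * _).
rewrite /A mulmxDl -!scalemxAl mulmxBl mul1mx raddfD /= !mxtraceZ raddfB /=.
rewrite -tN -mulrDl addrC subrK mul1r mulr_natl mulr2n {1}tN.
by rewrite subrK.
Qed.

Definition occupation c : op := P c (index_enum 'I_n).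

Lemma occupation_tr1 c : \tr (occupation c) = 1.
Proof.
have := occupation_trace c (index_enum_uniq 'I_n).
have -> : size (index_enum 'I_n) = n by rewrite -[RHS]card_ord cardT enumT.
rewrite -[RHS]mulr1; apply: mulfI.
by rewrite pnatr_eq0 expn_eq0.
Qed.

Lemma occupation_pure c : (forall p, c p * c p = c p) -> (forall p, (c p) ^* = c p) ->
  pure (occupation c).
Proof.
move=> cc cr; apply: projection_trace1_pure.
- exact: occupation_adj.
- exact: occupation_idem.
- exact: occupation_tr1.
Qed.

(* Wick's theorem in the form of a contraction rule: moving the creation operator
   around the trace by [occupation_creation] leaves c times an anticommutator. *)
Lemma wick_creation c k (X : op) :
  \tr (occupation c *m ((b k) ^t* *m X)) =
  c k * \tr (occupation c *m ((b k) ^t* *m X + X *m (b k) ^t*)).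
Proof.
have := congr1 (fun Y : op => \tr (Y *m X))
  (occupation_creation c (index_enum_uniq 'I_n) (mem_index_enum k)).
rewrite -/(occupation c) -!scalemxAl !mxtraceZ -!mulmxA.
rewrite (mxtrace_mulC ((b k) ^t*)) -mulmxA => E.
rewrite mulmxDr mxtraceD; move: E; move: (\tr _) (\tr _) (c k) => x y z E.
by rewrite mulrDr -E -mulrDl addrCA subrr addr0 mul1r.
Qed.

(** Multiplying out the product over the modes. For [c] in [0,1] the coefficients are the
    probabilities of independent occupations, so this writes a mixed product state as a mixture of
    pure ones. *)
Lemma occupation_expand c : occupation c =
  \sum_(f : {ffun 'I_n -> bool})
    (\prod_p (if f p then c p else 1 - c p)) *: occupation (fun p => (f p)%:R).
Proof.
pose F p (x : bool) : op :=
  (if x then c p else 1 - c p) *: (if x then N p else 1%:M - N p).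
have -> : occupation c = \prod_p \sum_(x : bool) F p x.
  by apply: eq_bigr => p _; rewrite /F big_bool.
rewrite bigA_distr_bigA; apply: eq_bigr => f _.
rewrite [LHS]scalemx_prod; congr (_ *: _); apply: eq_bigr => p _.
rewrite /A; case: (f p); rewrite ?scale1r ?subrr ?scale0r ?addr0 //.
by rewrite subr0 scale1r add0r.
Qed.

Lemma number_factor (f : 'I_n -> bool) p :
  N p *m A (fun p => (f p)%:R) p = (f p)%:R *: A (fun p => (f p)%:R) p.
Proof.
rewrite /A; case: (f p); rewrite ?scale1r ?subrr ?scale0r ?addr0 ?number_idem //.
by rewrite subr0 scale1r add0r mulmxBr mulmx1 number_idem subrr.
Qed.

Lemma number_occupation (f : 'I_n -> bool) p :
  N p *m occupation (fun p => (f p)%:R) = (f p)%:R *: occupation (fun p => (f p)%:R).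
Proof.
rewrite /occupation; move: (mem_index_enum p); elim: (index_enum _) => [//|q r IH].
rewrite inE occupation_cons mulmxA; have [<- _|pq /= pr] := eqVneq p q.
  by rewrite number_factor scalemxAl.
by rewrite -(factor_comm _ (number_comm q p)) -mulmxA IH // -scalemxAr.
Qed.

End Modes.

(** * Unitarily rotated modes and Wick's theorem in the original modes *)

Section Rotation.
Variables (R : realType) (n : nat).
Local Notation op := 'M[R[i]]_(2 ^ n).
Variable a : 'I_n -> op.
Hypothesis ha : fermionic_modes a.
Variable U : 'M[R[i]]_n.
Hypothesis hU : U \is unitarymx.
Implicit Types (j k l p q : 'I_n) (c : 'I_n -> R[i]) (X : op).

(* The conjugate makes the creation operators transform by U itself. *)
Definition rotated_mode p : op := \sum_j (U p j)^* *: a j.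

Lemma rotated_mode_adj p : (rotated_mode p) ^t* = \sum_j U p j *: (a j) ^t*.
Proof. by rewrite adj_sum; apply: eq_bigr => j _; rewrite adjZ conjCK. Qed.

Lemma unitary_rows p q : \sum_j U p j * (U q j)^* = (p == q)%:R.
Proof.
have /matrixP/(_ p q) := unitarymxP hU; rewrite !mxE => <-.
by apply: eq_bigr => j _; rewrite !mxE.
Qed.

Lemma unitary_cols j k : \sum_p (U p j)^* * U p k = (j == k)%:R.
Proof.
have /matrixP/(_ j k) : U ^t* *m U = 1%:M.
  by rewrite -invmx_unitary // mulVmx // unitarymx_unit.
by rewrite !mxE => <-; apply: eq_bigr => p _; rewrite !mxE.
Qed.

Lemma rotated_modes : fermionic_modes rotated_mode.
Proof.
split=> p q.
  rewrite rotated_mode_adj mulmx_suml mulmx_sumr -big_split /=.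
  rewrite eq_sym -unitary_rows (raddf_sum (@scalar_mx _ _)) /=.
  under eq_bigr do rewrite mulmx_sumr mulmx_suml -big_split /=.
  rewrite exchange_big /=; apply: eq_bigr => k _.
  rewrite (bigD1 k) //= big1 => [|j jk].
    rewrite -!scalemxAl -!scalemxAr !scalerA mulrC -scalerDr.
    by rewrite ha.1 eqxx scale_scalar_mx mulr1 addr0.
  rewrite -!scalemxAl -!scalemxAr !scalerA mulrC -scalerDr.
  by rewrite ha.1 (negbTE jk) scale_scalar_mx mulr0 raddf0.
rewrite mulmx_suml mulmx_sumr -big_split big1 //= => j _.
rewrite mulmx_sumr mulmx_suml -big_split big1 //= => k _.
by rewrite -!scalemxAl -!scalemxAr !scalerA mulrC -scalerDr ha.2 scaler0.
Qed.

Definition rotated_state c : op := occupation rotated_mode c.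

(** The two-point matrix of [rotated_state c], by [two_point]. It is already in spectral form, so a
    prescribed Hermitian matrix is reached by diagonalizing it. *)
Definition correlation c : 'M[R[i]]_n := U ^t* *m diag_mx (\row_p c p) *m U.

Lemma correlationE c j k : correlation c j k = \sum_p (U p j)^* * c p * U p k.
Proof.
rewrite /correlation mul_mx_diag mxE; apply: eq_bigr => p _.
by rewrite !mxE.
Qed.

(** Orthonormality of the columns of [U] inverts the rotation. *)
Lemma creation_rotated j : (a j) ^t* = \sum_p (U p j)^* *: (rotated_mode p) ^t*.
Proof.
under eq_bigr do rewrite rotated_mode_adj scaler_sumr.
rewrite exchange_big /= (bigD1 j) //= [X in _ = _ + X]big1 => [|k kj].
  under eq_bigr do rewrite scalerA.
  by rewrite -scaler_suml unitary_cols eqxx scale1r addr0.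
under eq_bigr do rewrite scalerA.
by rewrite -scaler_suml unitary_cols eq_sym (negbTE kj) scale0r.
Qed.

(** The contraction rule is diagonal in the rotated modes. Expanding the creation operator in them,
    contracting, and expanding back turns the factors [c p] into the entries of [correlation c]. *)
Lemma wick c j X :
  \tr (rotated_state c *m ((a j) ^t* *m X)) =
  \sum_l correlation c j l *
    \tr (rotated_state c *m ((a l) ^t* *m X + X *m (a l) ^t*)).
Proof.
rewrite creation_rotated mulmx_suml mulmx_sumr raddf_sum /=.
under eq_bigr => p _.
  rewrite -scalemxAl -scalemxAr mxtraceZ (wick_creation rotated_modes).
  rewrite rotated_mode_adj mulmx_suml mulmx_sumr -big_split mulmx_sumr raddf_sum /=.
  rewrite mulrA mulr_sumr.
  under eq_bigr => l _.
    rewrite -scalemxAl -scalemxAr -scalerDr -scalemxAr mxtraceZ mulrA.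
    over.
  over.
rewrite exchange_big /=; apply: eq_bigr => l _.
by rewrite -mulr_suml correlationE.
Qed.

Lemma rotated_state_tr1 c : \tr (rotated_state c) = 1.
Proof. exact: (occupation_tr1 rotated_modes). Qed.

Lemma two_point c j k :
  \tr (rotated_state c *m ((a j) ^t* *m a k)) = correlation c j k.
Proof.
rewrite wick (bigD1 k) //= big1 => [|l lk]; rewrite (car_rev ha).
  by rewrite eqxx mulmx1 rotated_state_tr1 mulr1 addr0.
by rewrite eq_sym (negbTE lk) raddf0 mulmx0 mxtrace0 mulr0.
Qed.

Lemma two_point_rev c j k : j != k ->
  \tr (rotated_state c *m (a j *m (a k) ^t*)) = - correlation c k j.
Proof.
by move=> /negbTE jk; rewrite (car ha) jk raddf0 sub0r mulmxN raddfN /= two_point.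
Qed.

(** Wick's theorem for four operators. Contracting the leftmost creation operator leaves two terms:
    [l = j] yields the product of densities, and [l = k] yields the exchange term with its minus
    sign. *)
Lemma number_two_point c j k : j != k ->
  \tr (rotated_state c *m (Defs.number a j *m Defs.number a k)) =
  correlation c j j * correlation c k k - correlation c j k * correlation c k j.
Proof.
move=> jk.
have anti l : (a l) ^t* *m (a j *m Defs.number a k) + a j *m Defs.number a k *m (a l) ^t* =
    (j == l)%:R *: Defs.number a k + (k == l)%:R *: (a j *m (a k) ^t*).
  have Nl : Defs.number a k *m (a l) ^t* =
      (a l) ^t* *m Defs.number a k + (k == l)%:R *: (a k) ^t*.
    have [<-|kl] := eqVneq k l.
      by rewrite (number_creation ha) (creation_number ha) add0r scale1r.
    by rewrite (number_creation_comm ha) // scale0r addr0.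
  move: (Defs.number a k) Nl => Nk Nl.
  rewrite -[X in _ + X]mulmxA Nl mulmxDr addrA !mulmxA -mulmxDl.
  rewrite (car_rev ha).
  congr (_ + _).
    exact: mul_scalar_mx.
  by rewrite scalemxAr.
rewrite [Defs.number a j]/Defs.number -mulmxA wick.
under eq_bigr => l _ do
  rewrite anti mulmxDr mxtraceD -!scalemxAr !mxtraceZ mulrDr.
rewrite big_split /=.
rewrite (bigD1 j isT) /=.
rewrite big1 => [|l lj]; last first.
  by rewrite eq_sym (negbTE lj) mul0r mulr0.
rewrite (bigD1 k) //= big1 => [|l lk]; last first.
  by rewrite eq_sym (negbTE lk) mul0r mulr0.
by rewrite !eqxx !mul1r two_point two_point_rev // mulrN !addr0.
Qed.

End Rotation.

(** * Occupation states of rotated modes as pure Gaussian states *)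

Section GaussianForm.
Variables (R : realType) (n : nat).
Local Notation op := 'M[R[i]]_(2 ^ n).

Lemma maj_indexP (m : 'I_n.*2) : m = maj1 (mode m) \/ m = maj2 (mode m).
Proof.
case mE: (odd m); [right | left]; apply: val_inj => /=.
  by rewrite -[LHS](odd_double_half m) mE.
by rewrite -[LHS](odd_double_half m) mE.
Qed.

Lemma mode_maj1 (j : 'I_n) : mode (maj1 j) = j.
Proof. by apply: val_inj => /=; rewrite doubleK. Qed.

Lemma mode_maj2 (j : 'I_n) : mode (maj2 j) = j.
Proof. by apply: val_inj => /=; rewrite uphalf_double. Qed.

Lemma odd_maj1 (j : 'I_n) : odd (maj1 j) = false.
Proof. by rewrite /= odd_double. Qed.

Lemma odd_maj2 (j : 'I_n) : odd (maj2 j).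
Proof. by rewrite /= odd_double. Qed.

Lemma maj1_eq (p q : 'I_n) : (maj1 p == maj1 q) = (p == q).
Proof. by rewrite -!val_eqE /= (inj_eq double_inj). Qed.

Lemma maj2_eq (p q : 'I_n) : (maj2 p == maj2 q) = (p == q).
Proof. by rewrite -!val_eqE /= eqSS (inj_eq double_inj). Qed.

Lemma maj12_eq (p q : 'I_n) : (maj1 p == maj2 q) = false.
Proof. by apply: contra_eqF (odd_maj1 p) => /eqP ->; rewrite odd_maj2. Qed.

Lemma big_majorana (V : Type) (idx : V) (f : Monoid.com_law idx) (F : 'I_n.*2 -> V) :
  \big[f/idx]_m F m = \big[f/idx]_j f (F (maj1 j)) (F (maj2 j)).
Proof.
rewrite (reindex (fun x : 'I_n * bool => if x.2 then maj2 x.1 else maj1 x.1)) /=.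
  rewrite -(pair_bigA _ (fun j (x : bool) => F (if x then maj2 j else maj1 j))) /=.
  by apply: eq_bigr => j _; rewrite big_bool Monoid.mulmC.
exists (fun m : 'I_n.*2 => (mode m, odd m)) => [[j [] _]|m _] /=.
- by rewrite mode_maj2 odd_double.
- by rewrite mode_maj1 odd_double.
- case: (maj_indexP m) => ->; first by rewrite odd_maj1 mode_maj1.
  by rewrite odd_maj2 mode_maj2.
Qed.

Lemma sum_majorana (V : nmodType) (F : 'I_n.*2 -> V) :
  \sum_m F m = \sum_j (F (maj1 j) + F (maj2 j)).
Proof. exact: big_majorana. Qed.

Lemma Re_sum (I : finType) (F : I -> R[i]) :
  complex.Re (\sum_i F i) = \sum_i complex.Re (F i).
Proof. by apply: (big_morph (@complex.Re R) _ erefl); case=> x y; case. Qed.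

Lemma Im_sum (I : finType) (F : I -> R[i]) :
  complex.Im (\sum_i F i) = \sum_i complex.Im (F i).
Proof. by apply: (big_morph (@complex.Im R) _ erefl); case=> x y; case. Qed.

Variable U : 'M[R[i]]_n.
Hypothesis hU : U \is unitarymx.

(* The action of U on the real span of the Majorana operators; the signs eps on
   the odd rows serve to adjust the determinant. *)
Definition majorana_rotation (eps : 'I_n -> R) : 'M[R]_n.*2 :=
  \matrix_(m, k)
    let u := U (mode m) (mode k) in
    if odd m then eps (mode m) * (if odd k then complex.Re u else complex.Im u)
    else (if odd k then - complex.Im u else complex.Re u).

(** This and [Im_row_dot] are the real and imaginary parts of the orthonormality of the rows of [U].
    They supply the entries of Q Q^T for the real rotation Q. *)
Lemma Re_row_dot (p q : 'I_n) :
  \sum_j (complex.Re (U p j) * complex.Re (U q j) +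
          complex.Im (U p j) * complex.Im (U q j)) = (p == q)%:R.
Proof.
have := congr1 (@complex.Re R) (unitary_rows hU p q).
rewrite Re_sum; have -> : complex.Re (p == q)%:R = (p == q)%:R :> R by case: eqP.
move=> <-; apply: eq_bigr => j _; case: (U p j) => x y; case: (U q j) => z t /=.
by rewrite mulrN opprK.
Qed.

Lemma Im_row_dot (p q : 'I_n) :
  \sum_j (complex.Im (U p j) * complex.Re (U q j) -
          complex.Re (U p j) * complex.Im (U q j)) = 0.
Proof.
have := congr1 (@complex.Im R) (unitary_rows hU p q).
rewrite Im_sum; have -> : complex.Im (p == q)%:R = 0 :> R by case: eqP.
move=> S0; rewrite -[RHS]S0; apply: eq_bigr => j _.
case: (U p j) => x y; case: (U q j) => z t /=.
by rewrite mulrN addrC.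
Qed.

Lemma majorana_rotation_orth eps : (forall j, eps j * eps j = 1) ->
  majorana_rotation eps *m (majorana_rotation eps)^T = 1%:M.
Proof.
move=> eps2; apply/matrixP => m m'; rewrite !mxE sum_majorana.
under eq_bigr do rewrite !mxE.
case: (maj_indexP m) => ->; case: (maj_indexP m') => ->;
  move: (mode m) (mode m') => p q.
- rewrite maj1_eq -Re_row_dot; apply: eq_bigr => j _.
  by rewrite !odd_maj1 !odd_maj2 !mode_maj1 !mode_maj2 mulrNN.
- rewrite maj12_eq -[RHS](mulr0 (- eps q)) -[X in _ = _ * X](Im_row_dot p q) mulr_sumr.
  apply: eq_bigr => j _.
  rewrite !odd_maj1 !odd_maj2 !mode_maj1 !mode_maj2.
  by rewrite /=; ring.
- rewrite eq_sym maj12_eq -[RHS](mulr0 (eps p)) -[X in _ = _ * X](Im_row_dot p q) mulr_sumr.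
  apply: eq_bigr => j _.
  rewrite !odd_maj1 !odd_maj2 !mode_maj1 !mode_maj2.
  by rewrite /=; ring.
- rewrite maj2_eq; transitivity (eps p * eps q * (p == q)%:R); last first.
    by have [<-|_] := eqVneq p q; rewrite ?mulr0 // mulr1.
  rewrite -Re_row_dot mulr_sumr; apply: eq_bigr => j _.
  rewrite !odd_maj1 !odd_maj2 !mode_maj1 !mode_maj2.
  by rewrite /=; ring.
Qed.

Lemma majorana_rotation_det eps :
  \det (majorana_rotation eps) =
  (\prod_j eps j) * \det (majorana_rotation (fun=> 1)).
Proof.
pose d : 'rV[R]_n.*2 := \row_m (if odd m then eps (mode m) else 1).
have -> : majorana_rotation eps = diag_mx d *m majorana_rotation (fun=> 1).
  apply/matrixP => m k; rewrite mul_diag_mx !mxE.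
  by rewrite /=; case: (odd m); rewrite ?mul1r.
rewrite det_mulmx det_diag big_majorana; congr (_ * _).
apply: eq_bigr => j _.
by rewrite -[RHS]mul1r !mxE odd_maj1 odd_maj2 mode_maj2.
Qed.

(** Orthogonality forces the determinant [e] at trivial signs to satisfy [e * e = 1], so using [e]
    itself as the sign of a single odd row makes the determinant [e * e]. *)
Lemma majorana_rotation_special : exists eps : 'I_n -> R,
  (forall j, eps j * eps j = 1) /\ special_orthogonal (majorana_rotation eps).
Proof.
pose e : R := \det (majorana_rotation (fun=> 1)).
have e2 : e * e = 1.
  by rewrite /e -[X in _ * X]det_tr -det_mulmx majorana_rotation_orth ?det1 ?mulr1.
have [n0|/card_gt0P[j0 _]] := posnP #|'I_n|.
  (* Without modes there is no row to flip, but the determinant of the empty matrix is 1. *)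
  exists (fun=> 1); split=> [j|]; first by rewrite mulr1.
  split; first by apply: majorana_rotation_orth => j; rewrite mulr1.
  move: n0 @e e2; rewrite card_ord => n0 e _.
  by rewrite /determinant; move: (majorana_rotation _); rewrite n0 => Q; exact: det_mx00.
pose eps j := if j == j0 then e else 1.
have eps2 j : eps j * eps j = 1 by rewrite /eps; case: eqP; rewrite ?mulr1.
exists eps; split=> //; split; first exact: majorana_rotation_orth.
rewrite majorana_rotation_det (bigD1 j0) //= big1 => [|j jj]; last first.
  by rewrite /eps (negbTE jj).
by rewrite /eps eqxx mulr1.
Qed.

Variable a : 'I_n -> op.
Hypothesis ha : fermionic_modes a.

Local Notation b := (rotated_mode a U).

Lemma scaler_sum_diff (x y : R[i]) (A B : op) :
  x *: (A + B) + y *: (A - B) = (x + y) *: A + (x - y) *: B.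
Proof. by rewrite scalerDl scalerBl scalerDr scalerBr addrACA. Qed.

(** With [rotated_maj2], this identifies the rotated Majorana operators as those of the rotated
    modes, up to the sign [eps p] on the second of each pair. *)
Lemma rotated_maj1 eps p :
  rotated_majorana a (majorana_rotation eps) (maj1 p) = b p + (b p) ^t*.
Proof.
rewrite rotated_mode_adj -big_split /= /rotated_majorana sum_majorana.
apply: eq_bigr => j _; rewrite !mxE odd_maj1 odd_maj2 odd_maj1 !mode_maj1 !mode_maj2.
rewrite /majorana odd_maj1 odd_maj2 mode_maj1 mode_maj2 scalerA scaler_sum_diff.
congr (_ *: _ + _ *: _); case: (U p j) => x y; apply/eqP;
  by rewrite eq_complex /= ?(mul0r, mulr0, mulr1, subr0, addr0, add0r, oppr0) ?opprK !eqxx.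
Qed.

Lemma rotated_maj2 eps p :
  rotated_majorana a (majorana_rotation eps) (maj2 p) =
  ((eps p)%:C * 'i%C) *: (b p - (b p) ^t*).
Proof.
rewrite rotated_mode_adj -sumrB scaler_sumr /rotated_majorana sum_majorana.
apply: eq_bigr => j _; rewrite !mxE odd_maj2 odd_maj1 odd_maj2 !mode_maj2 !mode_maj1.
rewrite /majorana odd_maj1 odd_maj2 mode_maj1 mode_maj2 scalerA scaler_sum_diff.
rewrite scalerBr !scalerA -scaleNr.
congr (_ *: _ + _ *: _); case: (U p j) => x y; apply/eqP;
  rewrite eq_complex /= ?(mul0r, mulr0, mulr1, subr0, addr0, add0r, oppr0, opprK, mulrN, mulNr);
  by rewrite ?sub0r !eqxx.
Qed.

(** For unrotated signs, i c_{2p-1} c_{2p} equals 1 - 2N, so an empty mode takes the value 1 and an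
    occupied one -1. The factor [eps p] cancels the sign carried by the odd row. *)
Definition occupation_lam (eps : 'I_n -> R) (f : 'I_n -> bool) (p : 'I_n) : R :=
  eps p * (-1) ^+ (f p).

(** Each Gaussian factor is twice the corresponding occupation factor, and the powers of 2 cancel
    the normalization. *)
Lemma gaussian_form_rotated eps (f : 'I_n -> bool) :
  (forall j, eps j * eps j = 1) ->
  gaussian_form a (majorana_rotation eps) (occupation_lam eps f) =
  rotated_state a U (fun p => (f p)%:R).
Proof.
move=> eps2; rewrite /gaussian_form.
have factorE p : 1%:M + ('i%C * (occupation_lam eps f p)%:C) *:
      (rotated_majorana a (majorana_rotation eps) (maj1 p) *m
       rotated_majorana a (majorana_rotation eps) (maj2 p)) =
    2%:R *: occupation_factor b (fun p => (f p)%:R) p.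
  rewrite rotated_maj1 rotated_maj2 -scalemxAr scalerA.
  have -> : 'i%C * (occupation_lam eps f p)%:C * ((eps p)%:C * 'i%C) =
      - (-1) ^+ f p :> R[i].
    have ii : 'i%C * 'i%C = -1 :> R[i] by rewrite -expr2 sqr_i.
    have ee : (eps p)%:C * (eps p)%:C = 1 :> R[i] by rewrite -rmorphM /= eps2.
    have -> : (occupation_lam eps f p)%:C = (eps p)%:C * (-1) ^+ f p.
      by rewrite rmorphM rmorphXn rmorphN1.
    move: ee ii; move: (eps p)%:C 'i%C ((-1) ^+ f p) => e i s ee ii.
    by rewrite (mulrCA i e s) mulrACA ee mul1r mulrAC ii mulN1r.
  have -> : (b p + (b p) ^t*) *m (b p - (b p) ^t*) = 2%:R *: Defs.number b p - 1%:M.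
    have hb := rotated_modes ha hU.
    rewrite mulmxDl !mulmxBr (mode_sqr hb) (adj_mode_sqr hb) (car hb) eqxx.
    by rewrite -/(Defs.number b p) sub0r subr0 opprB addrAC scaler_nat mulr2n.
  rewrite /occupation_factor; case: (f p).
    by rewrite subrr scale0r addr0 expr1 opprK !scale1r addrCA subrr addr0.
  rewrite scale0r add0r subr0 scale1r expr0 scaleN1r opprB addrA scalerBr.
  by rewrite [2%:R *: 1%:M]scaler_nat mulr2n.
rewrite (eq_bigr _ (fun p _ => factorE p)) scalemx_prod prodr_const card_ord.
rewrite scalerA natrX mulVf ?scale1r //.
by rewrite expf_eq0 pnatr_eq0 andbF.
Qed.

Lemma rotated_state_pure_gaussian (f : 'I_n -> bool) :
  pure_gaussian a (rotated_state a U (fun p => (f p)%:R)).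
Proof.
have [eps [eps2 Qso]] := majorana_rotation_special.
have pureP : pure (rotated_state a U (fun p => (f p)%:R)).
  apply: (occupation_pure (rotated_modes ha hU)) => p.
    by case: (f p); rewrite ?mulr1 ?mulr0.
  by rewrite conjC_nat.
split=> //; split.
  by case: pureP => psi [psi1 ->]; exact: psi_density.
exists (majorana_rotation eps), (occupation_lam eps f); split=> // [p|].
  rewrite -ler_norml /occupation_lam normrM normrX normrN1 expr1n mulr1.
  by rewrite -(@ler_pXn2r _ 2) ?nnegrE // -normrX expr2 eps2 normr1 expr1n.
by rewrite gaussian_form_rotated.
Qed.

End GaussianForm.

(** * Energies of the two candidate states *)

Section Energy.
Variables (R : realType) (n : nat).
Local Notation op := 'M[R[i]]_(2 ^ n).
Variable a : 'I_n -> op.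
Hypothesis ha : fermionic_modes a.
Variables (E E' : {set {set 'I_n}}) (w w' : {set 'I_n} -> R) (mu : 'I_n -> R).
Hypothesis hw : forall e, e \in E -> 0 <= w e.
Local Notation H := (hamiltonian a E E' w w' mu).
Local Notation N := (Defs.number a).

Definition diagonal_part : op :=
    \sum_(j < n) \sum_(k < n | (j < k)%N && ([set j; k] \in E))
      (w [set j; k])%:C *: (4^-1%:M - N j *m N k)
  + \sum_(j < n) (mu j)%:C *: (N j - 2^-1%:M).

Definition hopping_part : op :=
  \sum_(j < n) \sum_(k < n | (j < k)%N && ([set j; k] \in E'))
    (w' [set j; k])%:C *: (- ((a j) ^t* *m a k) - (a k) ^t* *m a j).

Lemma adj_exchange m (A B : 'M[R[i]]_m) :
  (- (A ^t* *m B) - B ^t* *m A) ^t* = - (A ^t* *m B) - B ^t* *m A.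
Proof. by rewrite adjD !adjN !adjM !trmxCK addrC. Qed.

Lemma hopping_adj : hopping_part ^t* = hopping_part.
Proof.
rewrite /hopping_part adj_sum; apply: eq_bigr => j _.
rewrite adj_sum; apply: eq_bigr => k _.
rewrite adjZ; congr (_ *: _); first by apply/CrealP/complex_realP; exists (w' [set j; k]).
exact: adj_exchange.
Qed.

Lemma hamiltonian_split : H = diagonal_part + hopping_part.
Proof. by []. Qed.

Lemma energy_split (rho : op) :
  \tr (rho *m H) = \tr (rho *m diagonal_part) + \tr (rho *m hopping_part).
Proof. by rewrite hamiltonian_split mulmxDr mxtraceD. Qed.

Lemma diagonal_energy (rho : op) : \tr rho = 1 ->
  \tr (rho *m diagonal_part) =
    \sum_(j < n) \sum_(k < n | (j < k)%N && ([set j; k] \in E))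
      (w [set j; k])%:C * (4^-1 - \tr (rho *m (N j *m N k)))
  + \sum_(j < n) (mu j)%:C * (\tr (rho *m N j) - 2^-1).
Proof.
move=> rho1; rewrite /diagonal_part mulmxDr mxtraceD !mulmx_sumr !raddf_sum /=.
congr (_ + _); apply: eq_bigr => j _; last first.
  by rewrite -scalemxAr mxtraceZ mulmxBr raddfB /= mul_mx_scalar mxtraceZ rho1 mulr1.
rewrite mulmx_sumr raddf_sum /=; apply: eq_bigr => k _.
by rewrite -scalemxAr mxtraceZ mulmxBr raddfB /= mul_mx_scalar mxtraceZ rho1 mulr1.
Qed.

Lemma hopping_energy (rho : op) :
  \tr (rho *m hopping_part) =
    \sum_(j < n) \sum_(k < n | (j < k)%N && ([set j; k] \in E'))
      (w' [set j; k])%:C *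
        (- \tr (rho *m ((a j) ^t* *m a k)) - \tr (rho *m ((a k) ^t* *m a j))).
Proof.
rewrite /hopping_part mulmx_sumr raddf_sum /=; apply: eq_bigr => j _.
rewrite mulmx_sumr raddf_sum /=; apply: eq_bigr => k _.
by rewrite -scalemxAr mxtraceZ mulmxBr mulmxN raddfB raddfN.
Qed.

Lemma herm_adj m (A : 'M[R[i]]_m) : A \is hermsymmx -> A ^t* = A.
Proof. by move/is_hermitianmxP; rewrite expr0 scale1r => <-. Qed.

Lemma herm_energy_real m (A B : 'M[R[i]]_m) : A ^t* = A -> B ^t* = B ->
  \tr (A *m B) \is Num.real.
Proof.
by move=> hA hB; apply/CrealP; rewrite -mxtrace_adj adjM hA hB mxtrace_mulC.
Qed.

(** If every [y i] were below [x], the nonnegative terms [p i * (x - y i)] would have sum at most 0,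
    which makes every weight vanish. Reality of [x] and [y i] turns the failure of [x <= y i] into
    [y i < x], the order being partial. *)
Lemma average_le (C : numDomainType) (I : finType) (p y : I -> C) (x : C) :
  (forall i, 0 <= p i) -> \sum_i p i = 1 -> (forall i, y i \is Num.real) ->
  x \is Num.real -> x <= \sum_i p i * y i -> exists i, x <= y i.
Proof.
move=> p0 p1 yr xr le; apply/existsP; apply: contraT.
rewrite negb_exists => /forallP lt.
have yx i : 0 < x - y i by rewrite subr_gt0 real_ltNge.
have py i : 0 <= p i * (x - y i) by rewrite mulr_ge0 // ltW.
have : \sum_i p i * (x - y i) == 0.
  rewrite eq_le sumr_ge0 ?andbT // (eq_bigr _ (fun i _ => mulrBr _ _ _)).
  by rewrite sumrB -mulr_suml p1 mul1r subr_le0.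
rewrite psumr_eq0 // => /allP p_eq0; move: p1; rewrite big1 => [/esym/eqP|i _].
  by rewrite oner_eq0.
have := p_eq0 i (mem_index_enum _); rewrite mulf_eq0 (gt_eqF (yx i)) orbF.
by move/eqP.
Qed.

Lemma pure_gaussian_energy_real rho : pure_gaussian a rho -> \tr (rho *m H) \is Num.real.
Proof.
move=> [[[[rh _] _] _] _]; apply: herm_energy_real; first exact: herm_adj rh.
exact: herm_adj (hamiltonian_hermitian E E' w w' mu ha).
Qed.

(** By [occupation_expand] the rotated state is a mixture of pure Gaussian states, and some member
    of a mixture has at least the average energy. *)
Lemma pure_gaussian_ge (U : 'M[R[i]]_n) (c : 'I_n -> R[i]) (x : R[i]) :
  U \is unitarymx -> (forall p, 0 <= c p <= 1) -> x \is Num.real ->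
  x <= \tr (rotated_state a U c *m H) ->
  exists rho, pure_gaussian a rho /\ x <= \tr (rho *m H).
Proof.
move=> hU c01 xr.
pose rho (f : {ffun 'I_n -> bool}) := rotated_state a U (fun p => (f p)%:R).
pose P (f : {ffun 'I_n -> bool}) : R[i] := \prod_p (if f p then c p else 1 - c p).
have expand : rotated_state a U c = \sum_f P f *: rho f.
  exact: occupation_expand.
rewrite {1}expand mulmx_suml raddf_sum /=.
under eq_bigr do rewrite -scalemxAl mxtraceZ.
move=> xle; have [||f|//|f xf] := average_le _ _ _ _ xle.
- move=> f; apply: prodr_ge0 => p _; have /andP[c0 c1] := c01 p.
  by case: (f p); rewrite ?subr_ge0.
- have := congr1 mxtrace expand; rewrite (rotated_state_tr1 ha hU) raddf_sum /= => ->.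
  by apply: eq_bigr => f _; rewrite mxtraceZ (rotated_state_tr1 ha hU) mulr1.
- exact/pure_gaussian_energy_real/rotated_state_pure_gaussian.
by exists (rho f); split=> //; exact: rotated_state_pure_gaussian.
Qed.

(** Taking every occupation probability equal to 1/2 makes the product state 2^-n times the identity
    and every weight in [occupation_expand] equal to 2^-n. *)
Lemma occupation_resolution : \sum_(f : {ffun 'I_n -> bool})
  occupation a (fun p => (f p)%:R) = 1%:M :> op.
Proof.
pose h : 'I_n -> R[i] := fun=> 2^-1.
have half : 1 - 2^-1 = 2^-1 :> R[i] by rewrite {1}(splitr 1) mul1r addrK.
have /esym := occupation_expand a h.
have -> : occupation a h = 2^-1 ^+ n *: 1%:M.
  pose g : 'I_n -> op := fun=> 2^-1 *: 1%:M.
  transitivity (\prod_p g p).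
    by apply: eq_bigr => p _; rewrite /occupation_factor /h half -scalerDr addrC subrK.
  rewrite [LHS]scalemx_prod prodr_const card_ord; congr (_ *: _).
  by rewrite (big1_eq _ _).
under eq_bigr => f _.
  rewrite (eq_bigr (fun=> 2^-1)) => [|p _]; last by rewrite /h half if_same.
  rewrite prodr_const card_ord; over.
rewrite -scaler_sumr => /scalerI; apply.
by rewrite expf_eq0 invr_eq0 pnatr_eq0 andbF.
Qed.

Lemma scalar_sub_eigen (X rho : op) (x y : R[i]) :
  X *m rho = y *: rho -> (x%:M - X) *m rho = (x - y) *: rho.
Proof. by move=> Xr; rewrite mulmxBl mul_scalar_mx Xr scalerBl. Qed.

Lemma diagonal_eigen (f : 'I_n -> bool) :
  exists x, diagonal_part *m occupation a (fun p => (f p)%:R) =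
            x *: occupation a (fun p => (f p)%:R).
Proof.
set rho := occupation _ _.
(* The eigenvalue is [diagonal_part] with each number operator replaced by its occupation number. *)
exists (\sum_(j < n) \sum_(k < n | (j < k)%N && ([set j; k] \in E))
      (w [set j; k])%:C * (4^-1 - (f k)%:R * (f j)%:R)
  + \sum_(j < n) (mu j)%:C * ((f j)%:R - 2^-1)).
rewrite /diagonal_part mulmxDl scalerDl !mulmx_suml !scaler_suml.
congr (_ + _); apply: eq_bigr => j _; last first.
  by rewrite -scalemxAl mulmxBl mul_scalar_mx number_occupation // -scalerBl scalerA.
rewrite mulmx_suml scaler_suml; apply: eq_bigr => k _.
rewrite -scalemxAl -[RHS]scalerA; congr (_ *: _); apply: scalar_sub_eigen.
by rewrite -mulmxA number_occupation // -scalemxAr number_occupation // scalerA.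
Qed.

Lemma rotated_mode1 : rotated_mode a 1%:M =1 a.
Proof.
move=> p; rewrite /rotated_mode (bigD1 p) //= big1 => [|j jp].
  by rewrite mxE eqxx conjC1 scale1r addr0.
by rewrite mxE eq_sym (negbTE jp) conjC0 scale0r.
Qed.

Lemma rotated_state1 c : rotated_state a 1%:M c = occupation a c.
Proof.
apply: eq_bigr => p _.
by rewrite /occupation_factor /Defs.number rotated_mode1.
Qed.

Lemma unitarymx1 : (1%:M : 'M[R[i]]_n) \is unitarymx.
Proof. by apply/unitarymxP; rewrite adj1 mulmx1. Qed.

Lemma occupation_pure_gaussian (f : 'I_n -> bool) :
  pure_gaussian a (occupation a (fun p => (f p)%:R)).
Proof. by rewrite -rotated_state1; apply: rotated_state_pure_gaussian unitarymx1 _ ha _. Qed.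

(** An occupation state is a rotated state with [U] the identity, so its correlation matrix is
    diagonal, while hopping terms only involve off-diagonal entries. *)
Lemma hopping_occupation (f : 'I_n -> bool) :
  \tr (occupation a (fun p => (f p)%:R) *m hopping_part) = 0.
Proof.
have corr j k : j != k -> \tr (occupation a (fun p => (f p)%:R) *m ((a j) ^t* *m a k)) = 0.
  move=> jk; rewrite -rotated_state1 two_point ?unitarymx1 // correlationE big1 // => p _.
  rewrite !mxE; have [->|_] := eqVneq p j; last by rewrite conjC0 !mul0r.
  by rewrite (negbTE jk) mulr0.
have zero (x y z : R[i]) : x = 0 -> y = 0 -> z * (- x - y) = 0.
  by move=> -> ->; rewrite oppr0 addr0 mulr0.
rewrite hopping_energy big1 // => j _; rewrite big1 // => k /andP[jk _].
have {}jk : j != k by rewrite -val_eqE /= ltn_eqF.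
have kj : k != j by rewrite eq_sym.
by apply: zero; exact: corr.
Qed.

(* Measuring sigma in the occupation basis keeps the expectation of the diagonal
   part and produces a mixture of occupation states. *)
Lemma diagonal_candidate (sigma : op) : density sigma ->
  exists rho, pure_gaussian a rho /\
    \tr (sigma *m diagonal_part) <= \tr (rho *m H).
Proof.
move=> [sp s1].
pose rho (f : {ffun 'I_n -> bool}) := occupation a (fun p => (f p)%:R).
have rho1 f : \tr (rho f) = 1 by exact: occupation_tr1.
have rhoP f : pure_gaussian a (rho f) by exact: occupation_pure_gaussian.
have res : \sum_f rho f = 1%:M by exact: occupation_resolution.
(* Since hopping vanishes on [rho f], the eigenvalue of the diagonal part is the full energy of
   [rho f]. *)
have rhoH f : diagonal_part *m rho f = \tr (rho f *m H) *: rho f.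
  have [x Dx] := diagonal_eigen f.
  by rewrite energy_split hopping_occupation addr0 mxtrace_mulC Dx mxtraceZ rho1 mulr1.
have E1 : \tr (sigma *m diagonal_part) =
    \sum_f \tr (sigma *m rho f) * \tr (rho f *m H).
  rewrite -[diagonal_part]mulmx1 -res !mulmx_sumr raddf_sum /=.
  by apply: eq_bigr => f _; rewrite rhoH -scalemxAr mxtraceZ mulrC.
have y_real f : \tr (rho f *m H) \is Num.real by exact: pure_gaussian_energy_real.
have p_ge0 f : 0 <= \tr (sigma *m rho f).
  have [_ [psi [_ ->]]] := rhoP f.
  by rewrite -{1}[psi]trmxCK; apply: psd_trace_ge0.
have x_real : \tr (sigma *m diagonal_part) \is Num.real.
  by rewrite E1; apply: rpred_sum => f _; rewrite rpredM // ger0_real.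
have p1 : \sum_f \tr (sigma *m rho f) = 1.
  by rewrite -raddf_sum -mulmx_sumr res mulmx1.
have xle : \tr (sigma *m diagonal_part) <=
    \sum_f \tr (sigma *m rho f) * \tr (rho f *m H) by rewrite -E1.
have [f xf] := average_le p_ge0 p1 y_real x_real xle.
by exists (rho f).
Qed.

(** Both N = b^* b and 1 - N = b b^* have nonnegative expectation. *)
Lemma number_expectation (b : 'I_n -> op) (sigma : op) p :
  fermionic_modes b -> density sigma -> 0 <= \tr (sigma *m Defs.number b p) <= 1.
Proof.
move=> hb [sp s1]; rewrite psd_trace_ge0 //=.
have := psd_trace_ge0 ((b p) ^t*) sp; rewrite trmxCK (car hb) eqxx mulmxBr mulmx1.
by rewrite raddfB /= s1 subr_ge0.
Qed.

(* With C the one-body correlation matrix of sigma, this is half of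
   1 + (C - diag C), hence lies between 0 and 1 as C does. *)
Definition centered_correlation (sigma : op) : 'M[R[i]]_n :=
  \matrix_(j, k) (2^-1 * (\tr (sigma *m ((a j) ^t* *m a k)) +
    (j == k)%:R * (1 - \tr (sigma *m N j)))).

Lemma centered_correlation_diag sigma j : centered_correlation sigma j j = 2^-1.
Proof. by rewrite mxE eqxx mul1r -/(Defs.number a j) addrC subrK mulr1. Qed.

Lemma centered_correlation_off sigma j k : j != k ->
  centered_correlation sigma j k = 2^-1 * \tr (sigma *m ((a j) ^t* *m a k)).
Proof. by move=> /negbTE jk; rewrite mxE jk mul0r addr0. Qed.

Lemma centered_correlation_herm sigma : density sigma ->
  centered_correlation sigma \is hermsymmx.
Proof.
move=> [[/herm_adj sh _] _]; apply/is_hermitianmxP; rewrite expr0 scale1r.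
apply/matrixP => j k.
transitivity ((centered_correlation sigma k j)^*); last by rewrite !mxE.
have [<-|jk] := eqVneq j k.
  by rewrite !centered_correlation_diag; apply/esym/CrealP; rewrite rpredV realn.
rewrite (centered_correlation_off _ jk) (centered_correlation_off _ (k := j)) 1?eq_sym //.
rewrite rmorphM /=; congr (_ * _).
  by apply/esym/CrealP; rewrite rpredV realn.
by rewrite -mxtrace_adj adjM sh adjM trmxCK mxtrace_mulC.
Qed.

(** The entry is the mean of two numbers in [0,1]: [s], the occupation of the rotated mode [p] in
    [sigma], and [t], the average of the vacancies [1 - \tr (sigma *m N j)] with weights |U_pj|^2,
    which sum to 1. *)
Lemma centered_correlation_bounds sigma (U : 'M[R[i]]_n) p :
  density sigma -> U \is unitarymx ->
  0 <= (U *m centered_correlation sigma *m U ^t*) p p <= 1.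
Proof.
move=> ds hU.
set s := \tr (sigma *m Defs.number (rotated_mode a U) p).
pose t := \sum_j U p j * (U p j)^* * (1 - \tr (sigma *m N j)).
have -> : (U *m centered_correlation sigma *m U ^t*) p p = 2^-1 * (s + t).
  have sE : s = \sum_j \sum_k
      U p j * (U p k)^* * \tr (sigma *m ((a j) ^t* *m a k)).
    rewrite /s /Defs.number rotated_mode_adj mulmx_suml mulmx_sumr raddf_sum /=.
    apply: eq_bigr => j _; rewrite mulmx_sumr mulmx_sumr raddf_sum /=.
    apply: eq_bigr => k _.
    by rewrite -scalemxAl -scalemxAr mxtraceZ -!scalemxAr mxtraceZ mulrA.
  have tE : t = \sum_j \sum_k
      U p j * (U p k)^* * ((j == k)%:R * (1 - \tr (sigma *m N j))).
    apply: eq_bigr => j _; rewrite (bigD1 j) //= big1 => [|k kj].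
      by rewrite eqxx mul1r addr0.
    by rewrite eq_sym (negbTE kj) mul0r mulr0.
  rewrite sE tE -big_split mulr_sumr mxE.
  under eq_bigr => k _ do rewrite mxE mulr_suml.
  rewrite exchange_big; apply: eq_bigr => j _.
  rewrite -big_split mulr_sumr; apply: eq_bigr => k _.
  by rewrite !mxE /= -mulrDr mulrAC mulrCA.
have /andP[s0 s1] : 0 <= s <= 1 by apply: number_expectation ds; exact: rotated_modes.
have nb j : 0 <= 1 - \tr (sigma *m N j) <= 1.
  have /andP[n0 n1] := number_expectation j ha ds.
  by rewrite subr_ge0 n1 lerBlDr lerDl.
have t0 : 0 <= t.
  apply: sumr_ge0 => j _; rewrite mulr_ge0 ?mul_conjC_ge0 //.
  by case/andP: (nb j).
have t1 : t <= 1.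
  have U1 := unitary_rows hU p p; rewrite eqxx in U1.
  rewrite -[leRHS]U1; apply: ler_sum => j _.
  by rewrite ler_piMr ?mul_conjC_ge0 //; case/andP: (nb j).
rewrite mulr_ge0 ?invr_ge0 ?addr_ge0 ?ler0n //=.
by rewrite mulrC ler_pdivrMr ?ltr0n // mul1r -[2%:R]/(1 + 1) lerD.
Qed.

Lemma hopping_candidate (sigma : op) : density sigma ->
  exists rho, pure_gaussian a rho /\
    2^-1 * \tr (sigma *m hopping_part) <= \tr (rho *m H).
Proof.
move=> ds; have [[sh _] _] := ds.
pose C := centered_correlation sigma.
have Ch : C \is hermsymmx by exact: centered_correlation_herm.
pose U := spectralmx C; pose c p : R[i] := spectral_diag C 0 p.
have hU : U \is unitarymx by exact: spectral_unitarymx.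
have CE : correlation U c = C.
  have /orthomx_spectralP CE := hermitian_normalmx Ch.
  apply: etrans (esym CE).
  have dE : \row_p c p = spectral_diag C by apply/matrixP => i p; rewrite mxE ord1.
  by rewrite /correlation dE -(invmx_unitary hU).
(* The [c p] are the eigenvalues of [C], hence its diagonal entries after conjugation by [U]. *)
have c01 p : 0 <= c p <= 1.
  have -> : c p = (U *m C *m U ^t*) p p; last exact: centered_correlation_bounds.
  rewrite -CE /correlation !mulmxA (unitarymxP hU) mul1mx -mulmxA.
  by rewrite (unitarymxP hU) mulmx1 !mxE eqxx.
have Cconj j k : C k j = (C j k)^*.
  by have /matrixP/(_ k j) := herm_adj Ch => <-; rewrite !mxE.
apply: (pure_gaussian_ge hU c01).
  rewrite rpredM ?rpredV ?realn //; apply: herm_energy_real; first exact: herm_adj.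
  exact: hopping_adj.
(* Hopping couples distinct modes only, and there [C] is half the correlation matrix of [sigma]. *)
have hopE : \tr (rotated_state a U c *m hopping_part) =
    2^-1 * \tr (sigma *m hopping_part).
  rewrite !hopping_energy mulr_sumr; apply: eq_bigr => j _.
  rewrite mulr_sumr; apply: eq_bigr => k /andP[jk _].
  have {}jk : j != k by rewrite -val_eqE /= ltn_eqF.
  have kj : k != j by rewrite eq_sym.
  have alg (x y z h : R[i]) : z * (- (h * x) - h * y) = h * (z * (- x - y)) by ring.
  apply: etrans (alg _ _ _ _); congr (_ * (- _ - _)).
    by rewrite two_point // CE; exact: centered_correlation_off.
  by rewrite two_point // CE; exact: centered_correlation_off.
rewrite energy_split hopE lerDr diagonal_energy; last exact: rotated_state_tr1.
(* All densities equal 1/2, so the chemical potential terms vanish. *)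
rewrite addr_ge0 ?sumr_ge0 // => j _; last first.
  by rewrite two_point // CE centered_correlation_diag subrr mulr0.
apply: sumr_ge0 => k /andP[jk jkE].
have {}jk : j != k by rewrite -val_eqE /= ltn_eqF.
rewrite number_two_point // CE !centered_correlation_diag (Cconj j k).
(* The product of the two densities cancels the constant 1/4, and the exchange term leaves the
   nonnegative w_jk |C_jk|^2. *)
have -> : 4^-1 = 2^-1 * 2^-1 :> R[i] by rewrite -invfM -natrM.
by rewrite opprB addrC subrK mulr_ge0 ?ler0c ?hw // mul_conjC_ge0.
Qed.

End Energy.

(** * Choice between the two candidates *)

Theorem theorem2p2 (R : realType) (n : nat)
    (a : 'I_n -> 'M[R[i]]_(2 ^ n)) (vac : 'cV[R[i]]_(2 ^ n))
    (ha : fermionic_modes a) (hvac : vacuum a vac)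
    (E E' : {set {set 'I_n}})
    (hE : forall e, e \in E -> #|e| = 2%N)
    (hE' : forall e, e \in E' -> #|e| = 2%N)
    (w w' : {set 'I_n} -> R) (mu : 'I_n -> R)
    (hw : forall e, e \in E -> 0 <= w e) :
  let H := hamiltonian a E E' w w' mu in
  exists rho : 'M[R[i]]_(2 ^ n),
    pure_gaussian a rho /\ (3^-1 * lambda_max H)%:C <= \tr (rho *m H).
Proof.
move=> H.
have [[sigma [ds sH]] _] : energies H (lambda_max H) /\ _ :=
  lambda_maxP (expn_gt0 2 n) (hamiltonian_hermitian E E' w w' mu ha).
have sh : sigma ^t* = sigma by case: ds => [[/herm_adj]].
have /complex_realP[y yE] : \tr (sigma *m hopping_part a E' w') \is Num.real.
  exact: herm_energy_real sh (hopping_adj _ _ _).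
have sE : \tr (sigma *m diagonal_part a E w mu) = (lambda_max H - y)%:C.
  apply/(addIr y%:C); rewrite -{1}yE -energy_split sH -rmorphD /=.
  by rewrite subrK.
have [rho1 [rho1P le1]] := diagonal_candidate ha E E' w w' mu ds.
have [rho2 [rho2P le2]] := hopping_candidate ha E' w' mu hw ds.
(* Here [y] is the hopping energy of the optimal [sigma]. If the diagonal energy is below a third of
   [lambda_max H], then [y] exceeds two thirds of it, and half of [y] exceeds one third. *)
have [le|lt] := lerP (3^-1 * lambda_max H) (lambda_max H - y).
  by exists rho1; split=> //; apply: le_trans le1; rewrite sE lecR.
exists rho2; split=> //; apply: le_trans le2.
have -> : 2^-1 * \tr (sigma *m hopping_part a E' w') = (2^-1 * y)%:C.
  by rewrite yE rmorphM /= fmorphV /= rmorph_nat.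
by rewrite lecR; lra.
Qed.
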